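(* Let $p\in[1,\infty]$, let $Y$ be a complex Banach space, let $(\mathcal G,+)$ be a countable discrete group and $\mathbf X=\ell^p(\mathcal G,Y)$, with $\mathcal P$ and $\mathcal L(\mathbf X,\mathcal P)$ as in the context. Let $(\Omega,\mathcal G,\alpha)$ be a dynamical system and $A:\Omega\to\mathcal L(\mathbf X,\mathcal P)$ a family of operators over it. Let $\Sigma:=\bigcup_{\omega\in\Omega}\operatorname{spec}(A(\omega))$ and $\lambda\in\mathbb C\setminus\Sigma$. Then $\|(\lambda-A(\omega))^{-1}\|=\|(\lambda-A(\nu))^{-1}\|$ for all pseudoergodic $\omega,\nu\in\Omega$. If $(\Omega,\mathcal G,\alpha)$ is minimal, then $\|(\lambda-A(\omega))^{-1}\|=\|(\lambda-A(\nu))^{-1}\|$ for all $\omega,\nu\in\Omega$.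
   Context: $(\mathcal G,+)$ is written additively but need not be abelian. Choose subsets $\mathcal G_n\subseteq\mathcal G$ with $\emptyset\neq\mathcal G_n\neq\mathcal G$, such that for each $m$ there is $N_m$ with $\mathcal G_m\subseteq\mathcal G_n$ for $n\ge N_m$, and $\bigcup_n\mathcal G_n=\mathcal G$; $P_n$ is multiplication by $\mathbf 1_{\mathcal G_n}$, $\mathcal P=(P_n)$. $K\in\mathcal L(\mathbf X)$ is $\mathcal P$-compact if $\|K(I-P_n)\|\to0$ and $\|(I-P_n)K\|\to0$; $\mathcal K(\mathbf X,\mathcal P)$ is the set of these and $\mathcal L(\mathbf X,\mathcal P)=\{A\in\mathcal L(\mathbf X):AK,KA\in\mathcal K(\mathbf X,\mathcal P)\ \forall K\in\mathcal K(\mathbf X,\mathcal P)\}$. $(A_n)$ converges $\mathcal P$-strongly to $A$ ($\mathcal P\text{-}\lim A_n=A$) if $\|K(A_n-A)\|+\|(A_n-A)K\|\to0$ for all $K\in\mathcal K(\mathbf X,\mathcal P)$. $V_gx=(x_{h+g})_{h\in\mathcal G}$. A dynamical system $(\Omega,\mathcal G,\alpha)$: $\Omega$ compact metric space, $\alpha$ maps $\mathcal G$ to homeomorphisms of $\Omega$ with $\alpha(g+h)=\alpha(g)\circ\alpha(h)$; minimal if every orbit is dense. $g_n\to\infty$ means $(g_n)$ eventually leaves every finite subset of $\mathcal G$; $L(\omega)=\{\nu:\exists g_n\to\infty,\ \alpha(g_n)(\omega)\to\nu\}$; $\omega$ is pseudoergodic if $L(\omega)=\Omega$. A family of operators over $(\Omega,\mathcal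 G,\alpha)$ is $A:\Omega\to\mathcal L(\mathbf X,\mathcal P)$ with $A(\alpha(g)(\omega))=V_gA(\omega)V_{-g}$ for all $\omega,g$, and such that $\omega_n\to\omega$ implies $\mathcal P\text{-}\lim A(\omega_n)=A(\omega)$. *)

(* Defs.v *)
From HB Require Import structures.
From mathcomp Require Import all_boot all_order all_algebra.
From mathcomp Require Import complex.
From mathcomp Require Import all_classical all_reals all_analysis.
Set Implicit Arguments. Unset Strict Implicit. Unset Printing Implicit Defensive.
Import Order.TTheory GRing.Theory Num.Theory.
Import numFieldNormedType.Exports.
Local Open Scope classical_set_scope.
Local Open Scope ring_scope.

(* A countable (discrete) group.  MathComp writes groups multiplicatively:
   the paper's  h + g, -g  become  (h * g)%g, (g^-1)%g. *)
#[short(type="countGroupType")]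
HB.structure Definition CountGroup := {G of Group G & Countable G}.

Section Lp.
Variables (R : realType) (G : countGroupType) (Y : normedModType R[i]).

Definition nrmY (y : Y) : R := complex.Re `|y|.

Definition lpnorm (p : \bar R) (x : G -> Y) : \bar R :=
  match p with
  | EFin r => poweR (\esum_(g in [set: G]) ((nrmY (x g)) `^ r)%:E)%E r^-1
  | EPInf => ereal_sup (range (fun g => (nrmY (x g))%:E))
  | ENInf => 0%E
  end.

Definition in_lp (p : \bar R) (x : G -> Y) : Prop := (lpnorm p x < +oo)%E.

(* operators are maps on Y-valued sequences; only their action on X matters *)
Definition Op := (G -> Y) -> (G -> Y).

Definition opnorm (p : \bar R) (A : Op) : \bar R :=
  ereal_sup [set lpnorm p (A x) | x in [set x | in_lp p x /\ (lpnorm p x <= 1)%E]].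

Definition bounded_op (p : \bar R) (A : Op) : Prop :=
  [/\ forall x, in_lp p x -> in_lp p (A x),
      forall (a : R[i]) (x y : G -> Y), in_lp p x -> in_lp p y ->
        A (fun g => a *: x g + y g) = (fun g => a *: A x g + A y g)
    & (opnorm p A < +oo)%E].

Definition eq_on_lp (p : \bar R) (A B : Op) : Prop :=
  forall x, in_lp p x -> A x = B x.

Definition opsub (A B : Op) : Op := fun x g => A x g - B x g.
Definition lam_sub (lam : R[i]) (A : Op) : Op := fun x g => lam *: x g - A x g.

Definition proj (S : set G) : Op := fun x g => if `[< S g >] then x g else 0.

Definition Pcompact (p : \bar R) (Gs : nat -> set G) (K : Op) : Prop :=
  [/\ bounded_op p K,
      (fun n => opnorm p (K \o opsub id (proj (Gs n)))) @ \oo --> 0%E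
    & (fun n => opnorm p (opsub id (proj (Gs n)) \o K)) @ \oo --> 0%E].

Definition LXP (p : \bar R) (Gs : nat -> set G) (A : Op) : Prop :=
  bounded_op p A /\
  forall K, Pcompact p Gs K -> Pcompact p Gs (A \o K) /\ Pcompact p Gs (K \o A).

Definition Plim (p : \bar R) (Gs : nat -> set G) (An : nat -> Op) (A : Op) : Prop :=
  forall K, Pcompact p Gs K ->
    (fun n => (opnorm p (K \o opsub (An n) A) + opnorm p (opsub (An n) A \o K))%E)
      @ \oo --> 0%E.

Definition shift (g : G) : Op := fun x h => x (h * g)%g.

Definition is_inverse (p : \bar R) (T B : Op) : Prop :=
  [/\ bounded_op p B, eq_on_lp p (T \o B) id & eq_on_lp p (B \o T) id].

Definition in_spectrum (p : \bar R) (A : Op) (lam : R[i]) : Prop :=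
  ~ exists B, is_inverse p (lam_sub lam A) B.

Section Dyn.
Variable (Omega : pseudoMetricType R).

Definition dyn_system (alpha : G -> Omega -> Omega) : Prop :=
  [/\ forall g, continuous (alpha g),
      forall g, exists beta : Omega -> Omega,
        [/\ cancel (alpha g) beta, cancel beta (alpha g) & continuous beta]
    & forall g h, alpha (g * h)%g = alpha g \o alpha h].

Definition minimal_system (alpha : G -> Omega -> Omega) : Prop :=
  forall w, closure (range (fun g => alpha g w)) = [set: Omega].

Definition to_infty (gs : nat -> G) : Prop :=
  forall F : set G, finite_set F -> \forall n \near \oo, ~ F (gs n).

Definition limit_set (alpha : G -> Omega -> Omega) (w : Omega) : set Omega :=
  [set nu | exists gs, to_infty gs /\ (fun n => alpha (gs n) w) @ \oo --> nu].

Definition pseudoergodic (alpha : G -> Omega -> Omega) (w : Omega) : Prop :=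
  limit_set alpha w = [set: Omega].

Definition op_family (p : \bar R) (Gs : nat -> set G)
    (alpha : G -> Omega -> Omega) (A : Omega -> Op) : Prop :=
  [/\ forall w, LXP p Gs (A w),
      forall w g, eq_on_lp p (A (alpha g w)) (shift g \o A w \o shift (g^-1)%g)
    & forall (ws : nat -> Omega) (w : Omega), ws @ \oo --> w ->
        Plim p Gs (fun n => A (ws n)) (A w)].
End Dyn.
End Lp.

(* Main.v *)
Require Import Defs.
From HB Require Import structures.
From mathcomp Require Import all_boot all_order all_algebra.
From mathcomp Require Import complex.
From mathcomp Require Import all_classical all_reals all_analysis.
From mathcomp Require Import ring lra.
Import Order.TTheory GRing.Theory Num.Theory.
Import numFieldNormedType.Exports.
Local Open Scope classical_set_scope.
Local Open Scope ring_scope.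
Set Implicit Arguments. Unset Strict Implicit. Unset Printing Implicit Defensive.

(* If [alpha (g_n) w] tends to [nu], then the norm of the resolvent at [nu] is
   at most that at [w]; both claims follow by exchanging [w] and [nu].  The
   operators [lam - A (alpha (g_n) w)] are conjugate to [lam - A w] by isometric
   shifts, so all of them are bounded below by [1 / M] where [M] is the norm of
   the resolvent at [w].  P-strong convergence, tested on [P_m], transfers this
   lower bound to [lam - A nu] on the range of each [P_m].  To reach all of the
   space one uses, for [p < +oo], that [P_m] tends strongly to the identity, and
   for [p = +oo] that [lam - A nu], being in L(X, P), almost commutes with
   multiplication by suitable slowly varying cutoffs supported in some [G_n]. *)

(** * The norm of [Y] and the l^p norms *)

Section ValueNorm.
Variables (R : realType) (Y : normedModType R[i]).

(** Nonnegativity in [R[i]] forces the imaginary part to vanish, so the [R[i]]-valued norm of [Y]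
    loses nothing when replaced by its real part. *)
Lemma ge0_ReK (c : R[i]) : 0 <= c -> c = (complex.Re c)%:C%C.
Proof. by move=> c0; rewrite [LHS]complexE (ger0_Im c0) mulr0 addr0. Qed.

Lemma nrmY_ge0 (y : Y) : 0 <= nrmY y.
Proof. by rewrite /nrmY -ler0c -ge0_ReK. Qed.

Lemma nrmYE (y : Y) : `|y| = (nrmY y)%:C%C.
Proof. exact: ge0_ReK. Qed.

Lemma nrmY0 : nrmY (0 : Y) = 0.
Proof. by rewrite /nrmY normr0. Qed.

Lemma nrmYD (x y : Y) : nrmY (x + y) <= nrmY x + nrmY y.
Proof. by rewrite -lecR rmorphD /= -!nrmYE ler_normD. Qed.

Lemma nrmYZ (c : R[i]) (y : Y) : nrmY (c *: y) = complex.Re `|c| * nrmY y.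
Proof.
apply: complexI; rewrite rmorphM /= -(ge0_ReK (normr_ge0 c)) -!nrmYE.
exact: normrZ.
Qed.

Lemma normC_ge0 (c : R[i]) : 0 <= complex.Re `|c|.
Proof. by rewrite -ler0c -ge0_ReK. Qed.

Lemma normC_real (c : R) : complex.Re `|c%:C%C| = `|c|.
Proof. by rewrite normc_def /= expr0n addr0 sqrtr_sqr. Qed.

Lemma nrmYZr (c : R) (y : Y) : nrmY (c%:C%C *: y) = `|c| * nrmY y.
Proof. by rewrite nrmYZ normC_real. Qed.

Lemma nrmYN (y : Y) : nrmY (- y) = nrmY y.
Proof. by rewrite /nrmY normrN. Qed.

End ValueNorm.

Section LpNorm.
Variables (R : realType) (G : countGroupType) (Y : normedModType R[i]).
Implicit Types (x y : G -> Y) (p : \bar R) (r a b c : R).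

Lemma ge0_esumZ (c : R) (u : G -> R) : 0 <= c -> (forall g, 0 <= u g) ->
  (\esum_(g in [set: G]) (c * u g)%:E <= c%:E * \esum_(g in [set: G]) (u g)%:E)%E.
Proof.
move=> c0 u0; apply: ge_ereal_sup => _ [F [finF _] <-].
under eq_fsbigr do rewrite EFinM.
rewrite -ge0_mule_fsumr; last by move=> i; rewrite lee_fin.
by apply: lee_wpmul2l => //; apply: ereal_sup_ubound; exists F.
Qed.

(** Taking powers is monotone on the nonnegative extended reals, so the outer root can be removed.
    Norm estimates then become estimates of sums of powers, with no finiteness to check first. *)
Lemma lpnormr_leP r x a : 1 <= r -> 0 <= a ->
  (lpnorm r%:E x <= a%:E)%E <->
  (\esum_(g in [set: G]) (nrmY (x g) `^ r)%:E <= (a `^ r)%:E)%E.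
Proof.
move=> r1 a0; rewrite /lpnorm.
have r0 : 0 < r by apply: lt_le_trans r1.
set S := esum _ _; have S0 : (0 <= S)%E.
  by apply: esum_ge0 => g _; rewrite lee_fin powR_ge0.
have rr1 : r * r^-1 = 1 by rewrite divff ?gt_eqF.
split=> [h|h].
- have -> : S = poweR (poweR S r^-1) r by rewrite -poweRrM mulrC rr1 poweRe1.
  rewrite -poweR_EFin; apply: gt0_ler_poweR => //; first exact: ltW.
  + by rewrite in_itv /= poweR_ge0 leey.
  + by rewrite in_itv /= lee_fin a0 leey.
- have -> : a%:E = poweR (a `^ r)%:E r^-1.
    by rewrite poweR_EFin -powRrM rr1 powRr1.
  apply: gt0_ler_poweR => //; first by rewrite invr_ge0 ltW.
  + by rewrite in_itv /= S0 leey.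
  + by rewrite in_itv /= lee_fin powR_ge0 leey.
Qed.

Lemma lpnormy_leP x a :
  (lpnorm +oo%E x <= a%:E)%E <-> (forall g, nrmY (x g) <= a).
Proof.
split=> [h g|h].
  by rewrite -lee_fin; apply: le_trans h; apply: ereal_sup_ubound; exists g.
by apply: ge_ereal_sup => _ [g _ <-]; rewrite lee_fin.
Qed.

Lemma lpnorm_ge0 p x : (0 <= lpnorm p x)%E.
Proof.
case: p => [r||] //=; first exact: poweR_ge0.
apply: (@le_trans _ _ (nrmY (x 1%g))%:E); first by rewrite lee_fin nrmY_ge0.
by apply: ereal_sup_ubound; exists 1%g.
Qed.

Lemma le_lpnorm p x y : (1 <= p)%E -> (forall g, nrmY (x g) <= nrmY (y g)) ->
  (lpnorm p x <= lpnorm p y)%E.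
Proof.
case: p => [r r1||] // h; rewrite /lpnorm.
- rewrite lee_fin in r1; have r0 : 0 <= r by apply: le_trans r1.
  apply: gt0_ler_poweR; first by rewrite invr_ge0.
  + by rewrite in_itv /= leey andbT; apply: esum_ge0 => g _; rewrite lee_fin powR_ge0.
  + by rewrite in_itv /= leey andbT; apply: esum_ge0 => g _; rewrite lee_fin powR_ge0.
  apply: le_esum => g _; rewrite lee_fin.
  by apply: ge0_ler_powR => //; rewrite nnegrE nrmY_ge0.
- move=> xy; apply: ge_ereal_sup => _ [g _ <-].
  apply: (@le_trans _ _ (nrmY (y g))%:E); first by rewrite lee_fin xy.
  by apply: ereal_sup_ubound; exists g.
Qed.

Lemma lpnorm_shift p g x : lpnorm p (Defs.shift g x) = lpnorm p x.
Proof.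
case: p => [r||] //=; rewrite /Defs.shift.
- congr (poweR _ _).
  rewrite [RHS](reindex_esum [set: G] [set: G] (fun h => (h * g)%g)) //.
  split=> // [h k _ _ /mulIg //|h _].
  by exists (h * g^-1)%g => //; rewrite mulgVK.
- congr ereal_sup; rewrite eqEsubset; split=> _ [h _ <-] /=.
    by exists (h * g)%g.
  by exists (h * g^-1)%g => //; rewrite mulgVK.
Qed.

(** Minkowski's inequality in terms of upper bounds. For finite [p] it comes from convexity of the
    power function at [u / a] and [v / b], with weights [a / (a + b)] and [b / (a + b)]; strict
    positivity of [a] and [b] permits the divisions. *)
Lemma lpnormD_le p x y a b : (1 <= p)%E -> 0 < a -> 0 < b ->
  (lpnorm p x <= a%:E)%E -> (lpnorm p y <= b%:E)%E ->
  (lpnorm p (fun g => x g + y g)%R <= (a + b)%:E)%E.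
Proof.
case: p => [r||] //.
- rewrite lee_fin => r1 a0 b0.
  have r0 : 0 <= r by apply: le_trans r1.
  have ab0 : 0 < a + b by apply: addr_gt0.
  move=> /(lpnormr_leP _ r1 (ltW a0)) hx /(lpnormr_leP _ r1 (ltW b0)) hy.
  apply/(lpnormr_leP _ r1 (ltW ab0)).
  have t01 : 0 <= a / (a + b) <= 1.
    apply/andP; split; first by apply: divr_ge0; exact: ltW.
    by rewrite ler_pdivrMr// mul1r lerDl ltW.
  pose ca := (a + b) `^ r * (a / (a + b)) / a `^ r.
  pose cb := (a + b) `^ r * (b / (a + b)) / b `^ r.
  have ca0 : 0 <= ca by rewrite /ca !mulr_ge0 ?invr_ge0 ?powR_ge0 ?(ltW a0) ?(ltW ab0).
  have cb0 : 0 <= cb by rewrite /cb !mulr_ge0 ?invr_ge0 ?powR_ge0 ?(ltW b0) ?(ltW ab0).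
  have key g : nrmY (x g + y g) `^ r <=
      ca * nrmY (x g) `^ r + cb * nrmY (y g) `^ r.
    set u := nrmY (x g); set v := nrmY (y g).
    have u0 : 0 <= u := nrmY_ge0 _. have v0 : 0 <= v := nrmY_ge0 _.
    apply: (@le_trans _ _ ((u + v) `^ r)).
      by apply: ge0_ler_powR; rewrite ?nnegrE ?nrmY_ge0 ?addr_ge0// nrmYD.
    have ua0 : 0 <= u / a by rewrite divr_ge0 // ltW.
    have vb0 : 0 <= v / b by rewrite divr_ge0 // ltW.
    have -> : u + v = (a + b) * (a / (a + b) * (u / a) + b / (a + b) * (v / b)).
      by field; rewrite !gt_eqF.
    have s0 : 0 <= b / (a + b) by rewrite divr_ge0 // ltW.
    have t0 : 0 <= a / (a + b) by case/andP: t01.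
    rewrite powRM ?(ltW ab0) ?(addr_ge0 (mulr_ge0 t0 ua0) (mulr_ge0 s0 vb0))//.
    have cvx : (a / (a + b) * (u / a) + b / (a + b) * (v / b)) `^ r <=
        a / (a + b) * (u / a) `^ r + b / (a + b) * (v / b) `^ r.
      have -> : b / (a + b) = 1 - a / (a + b) by field; rewrite gt_eqF.
      have := @convex_powR R r r1 (Itv01 t0 (proj2 (andP t01))) (u / a) (v / b).
      by rewrite !inE /= !in_itv /= !andbT => /(_ ua0 vb0); rewrite !convRE.
    move: cvx => /(ler_wpM2l (powR_ge0 (a + b) r)) /le_trans; apply.
    have powR_div c w : 0 < c -> 0 <= w -> (w / c) `^ r = w `^ r / c `^ r.
      move=> c0 w0; rewrite -[in RHS](divfK (lt0r_neq0 c0) w).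
      by rewrite [in RHS]powRM ?divr_ge0 ?(ltW c0)// mulfK // lt0r_neq0 // powR_gt0.
    have mulE (s t q w : R) : s * (t * (q * w)) = s * t * w * q by ring.
    by rewrite !powR_div // mulrDr /ca /cb !mulE.
  apply: (@le_trans _ _ (\esum_(g in [set: G])
      ((ca * nrmY (x g) `^ r)%:E + (cb * nrmY (y g) `^ r)%:E))%E).
    by apply: le_esum => g _; rewrite -EFinD lee_fin.
  rewrite esumD; [|by move=> g _; rewrite lee_fin mulr_ge0 ?powR_ge0..].
  have le_part (z : G -> Y) c d : 0 <= c ->
      (\esum_(g in [set: G]) (nrmY (z g) `^ r)%:E <= d%:E)%E ->
      (\esum_(g in [set: G]) (c * nrmY (z g) `^ r)%:E <= (c * d)%:E)%E.
    move=> c0 h; apply: (le_trans (ge0_esumZ c0 _)) => [g|].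
      exact: powR_ge0.
    by rewrite EFinM lee_wpmul2l.
  have -> : (a + b) `^ r = ca * a `^ r + cb * b `^ r.
    rewrite /ca /cb !divfK ?lt0r_neq0 ?powR_gt0//.
    by rewrite -mulrDr -mulrDl divff ?mulr1 // lt0r_neq0.
  by rewrite EFinD; apply: leeD; apply: le_part.
- move=> _ a0 b0 /lpnormy_leP hx /lpnormy_leP hy; apply/lpnormy_leP => g.
  by apply: (le_trans (nrmYD _ _)); apply: lerD.
Qed.

Lemma lpnormZ_le p x a (c : R[i]) : (1 <= p)%E -> 0 <= a ->
  (lpnorm p x <= a%:E)%E ->
  (lpnorm p (fun g => c *: x g)%R <= (complex.Re `|c| * a)%:E)%E.
Proof.
have c0 := normC_ge0 c.
case: p => [r||] //.
- rewrite lee_fin => r1 a0 /(lpnormr_leP _ r1 a0) hx.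
  apply/lpnormr_leP => //; first exact: mulr_ge0.
  under eq_esum do rewrite nrmYZ powRM ?nrmY_ge0//.
  apply: (le_trans (ge0_esumZ _ _)) => [|g|]; rewrite ?powR_ge0//.
  by rewrite powRM // EFinM lee_wpmul2l // lee_fin powR_ge0.
- move=> _ a0 /lpnormy_leP hx; apply/lpnormy_leP => g.
  by rewrite nrmYZ ler_wpM2l.
Qed.
End LpNorm.

(** * Operators on l^p *)

Lemma cvge0_small (R : realType) (u : nat -> \bar R) (e : R) : 0 < e ->
  u @ \oo --> 0%E -> exists N, forall n, (N <= n)%N -> (u n <= e%:E)%E.
Proof.
move=> e0 cu.
have : nbhs (0%E : \bar R) [set y | (y < e%:E)%E].
  by apply: open_nbhs_nbhs; split; [exact: open_ereal_lt_ereal|rewrite /= lte_fin].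
move=> /cu [N _ hN].
by exists N => n /hN /ltW.
Qed.

Section RealNorm.
Variables (R : realType) (G : countGroupType) (Y : normedModType R[i]).
Variables (p : \bar R) (p1 : (1 <= p)%E).
Implicit Types (x y : G -> Y) (a b c : R).

(** [fine] sends an infinite norm to 0, so a bound on [lpN] is informative only together with
    [in_lp]; this is why the estimates below usually assert both. *)
Definition lpN x : R := fine (lpnorm p x).

Lemma lpNE x : in_lp p x -> lpnorm p x = (lpN x)%:E.
Proof. by move=> xp; rewrite /lpN fineK // ge0_fin_numE // lpnorm_ge0. Qed.

Lemma lpN_ge0 x : 0 <= lpN x.
Proof. by rewrite /lpN fine_ge0 // lpnorm_ge0. Qed.

Lemma lpnorm_leE x a : (lpnorm p x <= a%:E)%E <-> in_lp p x /\ lpN x <= a.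
Proof.
split=> [h|[xp]]; last by rewrite (lpNE xp) lee_fin.
have xp : in_lp p x by rewrite /in_lp (le_lt_trans h) ?ltry.
by split=> //; rewrite -lee_fin -lpNE.
Qed.

Lemma le_lpN x y : (forall g, nrmY (x g) <= nrmY (y g)) -> in_lp p y ->
  in_lp p x /\ lpN x <= lpN y.
Proof.
move=> xy yp; apply/lpnorm_leE; rewrite -lpNE //; exact: le_lpnorm.
Qed.

(** A norm may be 0 while [lpnormD_le] asks for positive bounds: both norms are enlarged by [e / 2],
    and [e] then tends to 0. *)
Lemma lpND x y : in_lp p x -> in_lp p y ->
  in_lp p (fun g => x g + y g) /\ lpN (fun g => x g + y g) <= lpN x + lpN y.
Proof.
move=> xp yp.
have h e : 0 < e -> in_lp p (fun g => x g + y g) /\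
    lpN (fun g => x g + y g) <= lpN x + lpN y + e.
  move=> e0; apply/lpnorm_leE.
  have -> : lpN x + lpN y + e = (lpN x + e / 2) + (lpN y + e / 2) by field.
  have e20 : 0 < e / 2 by rewrite divr_gt0.
  apply: lpnormD_le => //; rewrite ?ltr_wpDl ?lpN_ge0//.
    by rewrite lpNE // lee_fin lerDl ltW.
  by rewrite lpNE // lee_fin lerDl ltW.
split; first exact: (h 1 ltr01).1.
by apply/ler_addgt0Pr => e /h[].
Qed.

Lemma lpNZ_le x (c : R[i]) : in_lp p x ->
  in_lp p (fun g => c *: x g) /\ lpN (fun g => c *: x g) <= complex.Re `|c| * lpN x.
Proof.
move=> xp; apply/lpnorm_leE; apply: lpnormZ_le; rewrite ?lpN_ge0//.
by rewrite lpNE.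
Qed.

Lemma lpNB x y : in_lp p x -> in_lp p y ->
  in_lp p (fun g => x g - y g) /\ lpN (fun g => x g - y g) <= lpN x + lpN y.
Proof.
move=> xp yp.
have [nyp leny] : in_lp p (fun g => - y g) /\ lpN (fun g => - y g) <= lpN y.
  by apply: le_lpN => // g; rewrite nrmYN.
have [sp les] := lpND xp nyp; split=> //.
by apply: le_trans les _; rewrite lerD2l.
Qed.

Lemma lpN_zero : in_lp p (fun _ : G => 0 : Y) /\ lpN (fun _ : G => 0 : Y) <= 0.
Proof.
apply/lpnorm_leE.
case: p p1 => [r r1||] //; last by move=> _; apply/lpnormy_leP => g; rewrite nrmY0.
rewrite lee_fin in r1; apply/lpnormr_leP => //.
(* The exponent must be nonzero here, because 0 to the power 0 is 1. *)
have r0 : r != 0 by rewrite gt_eqF // (lt_le_trans _ r1).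
by rewrite esum1 ?lee_fin ?powR_ge0// => g _; rewrite nrmY0 powR0.
Qed.

Let in_lp0 := lpN_zero.1.

Lemma lpN_proj (S : set G) x : in_lp p x ->
  in_lp p (Defs.proj S x) /\ lpN (Defs.proj S x) <= lpN x.
Proof.
by apply: le_lpN => g; rewrite /Defs.proj; case: ifP => // _; rewrite nrmY0 nrmY_ge0.
Qed.

Lemma lpN_projC (S : set G) x : in_lp p x ->
  in_lp p (opsub id (Defs.proj S) x) /\ lpN (opsub id (Defs.proj S) x) <= lpN x.
Proof.
apply: le_lpN => g; rewrite /opsub /Defs.proj; case: ifP => // _.
  by rewrite subrr nrmY0 nrmY_ge0.
by rewrite subr0.
Qed.

Lemma in_lp_shift g x : in_lp p x -> in_lp p (Defs.shift g x).
Proof. by rewrite /in_lp lpnorm_shift. Qed.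

Lemma lpN_shift g x : lpN (Defs.shift g x) = lpN x.
Proof. by rewrite /lpN lpnorm_shift. Qed.

Definition op_homog (A : Op G Y) := forall (c : R[i]) x, in_lp p x ->
  A (fun g => c *: x g) = (fun g => c *: A x g).

Lemma opnorm_ge0 (A : Op G Y) : (0 <= opnorm p A)%E.
Proof.
apply: (@le_trans _ _ (lpnorm p (A (fun=> 0)))); first exact: lpnorm_ge0.
apply: ereal_sup_ubound; exists (fun=> 0) => //; split; first exact: in_lp0.
by apply/(@lpnorm_leE _ 1); split=> //; apply: le_trans lpN_zero.2 _.
Qed.

(** [x] is scaled into the unit ball by [c^-1] for an arbitrary [c] above its norm, and [c] is then
    lowered to the norm; this treats vectors of norm 0 together with the others. Homogeneity
    suffices for it and passes easily to composites and differences. *)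
Lemma opnorm_le (A : Op G Y) a : op_homog A -> (opnorm p A <= a%:E)%E ->
  forall x, in_lp p x -> in_lp p (A x) /\ lpN (A x) <= a * lpN x.
Proof.
move=> hA leA x xp.
have a0 : 0 <= a by rewrite -lee_fin (le_trans (opnorm_ge0 A)).
have h c : lpN x < c -> in_lp p (A x) /\ lpN (A x) <= a * c.
  move=> xc; have c0 : 0 < c by apply: le_lt_trans xc; exact: lpN_ge0.
  have cC0 : c%:C%C != 0 :> R[i] by rewrite eq_complex /= eqxx andbT gt_eqF.
  pose z g := (c^-1)%:C%C *: x g.
  have [zp lez] := lpNZ_le (c^-1)%:C%C xp.
  have : (lpnorm p (A z) <= a%:E)%E.
    apply: le_trans leA; apply: ereal_sup_ubound; exists z => //; split=> //.
    apply/lpnorm_leE; split=> //; apply: le_trans lez _.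
    rewrite normC_real ger0_norm ?invr_ge0 ?(ltW c0) //.
    by rewrite mulrC ler_pdivrMr // mul1r ltW.
  move=> /(lpnormZ_le c%:C%C p1 a0) /lpnorm_leE.
  rewrite normC_real ger0_norm ?(ltW c0)// (mulrC c) hA //.
  suff -> : (fun g => c%:C%C *: ((c^-1)%:C%C *: A x g)) = A x by [].
  by apply/funext => g; rewrite scalerA -rmorphM /= divff ?gt_eqF // scale1r.
have [Ap _] := h (lpN x + 1) (ltr_pwDr ltr01 (lexx _)).
split=> //; apply/ler_addgt0Pr => e e0.
have d0 : 0 < e / (a + 1) by rewrite divr_gt0 // ltr_wpDl.
have [_ /le_trans] := h (lpN x + e / (a + 1)) (ltr_pwDr d0 (lexx _)); apply.
rewrite mulrDr lerD2l mulrA ler_pdivrMr ?ltr_wpDl//.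
by rewrite mulrDr mulr1 mulrC lerDl ltW.
Qed.

Lemma le_opnorm (A : Op G Y) a :
  (forall x, in_lp p x -> lpN x <= 1 -> in_lp p (A x) /\ lpN (A x) <= a) ->
  (opnorm p A <= a%:E)%E.
Proof.
move=> h; apply: ge_ereal_sup => _ [x [xp /lpnorm_leE[_ x1]] <-].
by apply/lpnorm_leE; exact: h.
Qed.

Lemma bounded_op0 (A : Op G Y) : bounded_op p A -> A (fun=> 0) = (fun=> 0).
Proof.
case=> _ linA _; have := linA 1 (fun=> 0) (fun=> 0) in_lp0 in_lp0.
rewrite (_ : (fun _ => _) = (fun=> 0)); last first.
  by apply/funext => g; rewrite scaler0 addr0.
move=> h; apply/funext => g; move/(congr1 (@^~ g)): h => /=.
by rewrite scale1r => /eqP; rewrite -subr_eq0 opprD addrA subrr sub0r oppr_eq0 => /eqP.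
Qed.

Lemma bounded_op_homog (A : Op G Y) : bounded_op p A -> op_homog A.
Proof.
move=> bA c x xp; case: (bA) => _ linA _.
have := linA c x (fun=> 0) xp in_lp0; rewrite bounded_op0 //.
have addf0 (z : G -> Y) : (fun g => z g + 0) = z.
  by apply/funext => g; rewrite addr0.
by rewrite !addf0.
Qed.

Lemma bounded_opD (A : Op G Y) x y : bounded_op p A -> in_lp p x -> in_lp p y ->
  A (fun g => x g + y g) = (fun g => A x g + A y g).
Proof.
move=> [_ linA _] xp yp; have := linA 1 x y xp yp.
rewrite (_ : (fun g => 1 *: x g + y g) = (fun g => x g + y g)); last first.
  by apply/funext => g; rewrite scale1r.
by move=> ->; apply/funext => g; rewrite scale1r.
Qed.

Lemma bounded_opE (A : Op G Y) : bounded_op p A ->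
  exists a : R, [/\ 0 <= a, opnorm p A = a%:E &
    forall x, in_lp p x -> in_lp p (A x) /\ lpN (A x) <= a * lpN x].
Proof.
move=> bA; have [_ _ Aoo] := bA; have A0 := opnorm_ge0 A.
have AE : opnorm p A = (fine (opnorm p A))%:E by rewrite fineK // ge0_fin_numE.
exists (fine (opnorm p A)); split=> //; first exact: fine_ge0.
by apply: opnorm_le; [exact: bounded_op_homog|rewrite -AE].
Qed.

Lemma bounded_op_proj (S : set G) : bounded_op p (@Defs.proj R G Y S).
Proof.
split=> [x xp|a x y _ _|]; first exact: (lpN_proj S xp).1.
  by apply/funext => g; rewrite /Defs.proj; case: ifP => // _; rewrite scaler0 addr0.
apply: (@le_lt_trans _ _ (1 : R)%:E); last exact: ltry.
apply: (@le_opnorm _ 1) => x xp x1; have [h1 h2] := @lpN_proj S x xp.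
by split=> //; exact: le_trans x1.
Qed.

Lemma op_homog_comp (A B : Op G Y) : op_homog A -> op_homog B ->
  (forall x, in_lp p x -> in_lp p (B x)) -> op_homog (A \o B).
Proof. by move=> hA hB Bp c x xp /=; rewrite hB // hA //; exact: Bp. Qed.

Lemma op_homog_sub (A B : Op G Y) : op_homog A -> op_homog B ->
  op_homog (opsub A B).
Proof.
by move=> hA hB c x xp; rewrite /opsub hA // hB //; apply/funext => g; rewrite scalerBr.
Qed.

Lemma op_homog_projC (S : set G) : op_homog (opsub id (@Defs.proj R G Y S)).
Proof.
by apply: op_homog_sub => //; apply: bounded_op_homog; exact: bounded_op_proj.
Qed.

End RealNorm.

(** * Projections onto the exhausting sets *)

Section Exhaustion.
Variables (R : realType) (G : countGroupType) (Y : normedModType R[i]).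
Variables (p : \bar R) (p1 : (1 <= p)%E) (Gs : nat -> set G).
Hypothesis Gs_incr : forall m, exists N, forall n, (N <= n)%N -> Gs m `<=` Gs n.
Hypothesis Gs_cover : \bigcup_n Gs n = [set: G].
Implicit Types (x y : G -> Y) (A : Op G Y) (a e : R).

Local Notation P n := (@Defs.proj R G Y (Gs n)).
Local Notation Q n := (opsub id (@Defs.proj R G Y (Gs n))).
Local Notation N := (lpN p).

Lemma opnorm_eq0 A : (forall x, A x = (fun=> 0)) -> opnorm p A = 0%E.
Proof.
move=> A0; apply/eqP; rewrite eq_le opnorm_ge0 // andbT.
by apply: (@le_opnorm _ _ _ _ _ 0) => x _ _; rewrite A0; exact: lpN_zero.
Qed.

(** Once [Gs n] contains [Gs m], both products of [P m] with [Q n] vanish identically. The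
    projections thus become available as test operators in [LXP] and [Plim]. *)
Lemma Pcompact_proj m : Pcompact p Gs (P m).
Proof.
have [K hK] := Gs_incr m.
split; first exact: bounded_op_proj.
- apply: cvg_near_cst; exists K => // n /hK sub; apply: opnorm_eq0 => x.
  apply/funext => g; rewrite /opsub /Defs.proj /=.
  by case: asboolP => // /sub /asboolP ->; rewrite subrr.
- apply: cvg_near_cst; exists K => // n /hK sub; apply: opnorm_eq0 => x.
  apply/funext => g; rewrite /opsub /Defs.proj /=.
  case: asboolP => // [/sub /asboolP ->|_]; first by rewrite subrr.
  by case: asboolP => _; rewrite subrr.
Qed.

(** Both [A \o P m] and [P m \o A] are P-compact. Hence [A] couples [Gs m] with the complement of a
    large [Gs n] only weakly, in either direction. *)
Lemma LXP_small A m e : LXP p Gs A -> 0 < e ->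
  exists K, forall n, (K <= n)%N -> forall x, in_lp p x ->
    [/\ in_lp p (Q n (A (P m x))), N (Q n (A (P m x))) <= e * N x,
        in_lp p (P m (A (Q n x))) & N (P m (A (Q n x))) <= e * N x].
Proof.
move=> [bA LA] e0; have [cAP cPA] := LA _ (Pcompact_proj m).
have [Alp _ _] := bA.
have [bAP _ /(cvge0_small e0) [K1 h1]] := cAP.
have [bPA /(cvge0_small e0) [K2 h2] _] := cPA.
exists (maxn K1 K2) => n; rewrite geq_max => /andP[/h1 n1 /h2 n2] x xp.
have hQ : op_homog p (Q n) by apply: op_homog_projC.
have hAP : op_homog p (Q n \o (A \o P m)).
  by apply: op_homog_comp => //; [exact: bounded_op_homog|case: bAP].
have hPA : op_homog p ((P m \o A) \o Q n).
  apply: op_homog_comp => //; first exact: bounded_op_homog.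
  by move=> z zp; exact: (lpN_projC p1 (Gs n) zp).1.
have [Q1 Q2] := opnorm_le p1 hAP n1 xp.
have [Q3 Q4] := opnorm_le p1 hPA n2 xp.
by split.
Qed.

(** With [P m] as test operator, P-strong convergence becomes norm convergence on the range of
    [P m]. *)
Lemma Plim_small (An : nat -> Op G Y) A m e : (forall n, bounded_op p (An n)) ->
  bounded_op p A -> Plim p Gs An A -> 0 < e ->
  exists n, forall x, in_lp p x ->
    N (fun g => An n (P m x) g - A (P m x) g) <= e * N x.
Proof.
move=> bAn bA lim e0.
have [K /(_ K (leqnn K)) h] := cvge0_small e0 (lim _ (Pcompact_proj m)).
have h' : (opnorm p (opsub (An K) A \o P m) <= e%:E)%E.
  by apply: le_trans h; rewrite leeDr // opnorm_ge0.
have hAP : op_homog p (opsub (An K) A \o P m).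
  apply: op_homog_comp.
  - by apply: op_homog_sub; exact: bounded_op_homog.
  - by apply: bounded_op_homog => //; exact: bounded_op_proj.
  - by move=> z zp; exact: (lpN_proj p1 (Gs m) zp).1.
by exists K => x xp; have [] := opnorm_le p1 hAP h' xp.
Qed.

Lemma finite_sub_Gs (F : set G) : finite_set F -> exists m, F `<=` Gs m.
Proof.
move=> /finite_seqP[s ->].
(* The inclusion is claimed for all large indices because the sets are only eventually nested; this
   form survives the induction by taking maxima. *)
suff [K hK] : exists K, forall n, (K <= n)%N -> [set` s] `<=` Gs n.
  by exists K; exact: hK.
elim: s => [|g s [K hK]]; first by exists 0%N.
have [m _ mg] : (\bigcup_n Gs n) g by rewrite Gs_cover.
have [K' hK'] := Gs_incr m; exists (maxn K K') => n.
rewrite geq_max => /andP[/hK sn /hK' mn] h /=; rewrite in_cons.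
by case/orP=> [/eqP ->|/sn//]; exact: mn.
Qed.

Lemma bounded_lam_sub A (lam : R[i]) : bounded_op p A ->
  exists2 C : R, 0 <= C & forall x, in_lp p x ->
    in_lp p (lam_sub lam A x) /\ N (lam_sub lam A x) <= C * N x.
Proof.
move=> bA; have [a [a0 _ ha]] := bounded_opE p1 bA.
exists (complex.Re `|lam| + a); first by rewrite addr_ge0 // normC_ge0.
move=> x xp; have [Axp leA] := ha x xp; have [lxp lel] := lpNZ_le p1 lam xp.
have [h1 h2] := lpNB p1 lxp Axp; split=> //.
by apply: le_trans h2 _; rewrite mulrDl lerD.
Qed.

Lemma proj_approx (r : R) y e : p = r%:E -> in_lp p y -> 0 < e ->
  exists m, in_lp p (Q m y) /\ N (Q m y) <= e.
Proof.
move=> pr yp e0; have r1 : 1 <= r by rewrite -lee_fin -pr.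
have r0 : 0 < r by apply: lt_le_trans r1.
pose u g := (nrmY (y g) `^ r)%:E.
have u0 g : (0 <= u g)%E by rewrite lee_fin powR_ge0.
pose S := (\esum_(g in [set: G]) u g)%E.
have S0 : (0 <= S)%E by apply: esum_ge0 => g _.
have Sfin : S \is a fin_num.
  rewrite ge0_fin_numE //.
  have : (lpnorm p y <= (N y)%:E)%E by rewrite lpNE.
  rewrite pr => /(lpnormr_leP _ r1 (lpN_ge0 _ _)) /le_lt_trans; apply.
  exact: ltry.
have er0 : 0 < e `^ r by rewrite powR_gt0.
have [_ [F [finF _] <-] hF] : exists2 s,
    [set (\sum_(g \in F) u g)%E | F in fsets [set: G]] s & (S - (e `^ r)%:E < s)%E.
  apply: ub_ereal_sup_adherent => //.
have [m Fm] := finite_sub_Gs finF.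
exists m; apply/lpnorm_leE; rewrite [in lpnorm p _]pr.
apply/lpnormr_leP => //; first exact: ltW.
have SE : (S = \sum_(g \in F) u g + \esum_(g in ~` F) u g)%E.
  rewrite /S (esumID F) // setTI setTI; congr (_ + _)%E.
  by rewrite esum_fset.
have t0 : (0 <= \esum_(g in ~` F) u g)%E by apply: esum_ge0 => g _.
have s0 : (0 <= \sum_(g \in F) u g)%E by apply: fsume_ge0 => // g _.
have tle : (\esum_(g in ~` F) u g <= (e `^ r)%:E)%E.
  (* Since the total is finite, so are both parts, and the claim reduces to real arithmetic. *)
  have aux (t v T : \bar R) (d : R) : (0 <= t)%E -> (0 <= v)%E ->
      T \is a fin_num -> (T - d%:E < v)%E -> (T = v + t)%E -> (t <= d%:E)%E.
    case: t v T => [t||] [v||] [T||] //= _ _ _.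
    by rewrite -EFinB lte_fin -EFinD lee_fin => h [TE]; lra.
  exact: aux Sfin hF SE.
apply: le_trans tle; rewrite [leRHS]esum_mkcond; apply: le_esum => g _.
have rN0 : r != 0 by rewrite gt_eqF.
case: ifPn => [_|]; rewrite /opsub /Defs.proj; last first.
  rewrite in_setC negbK inE => /Fm /asboolP ->.
  by rewrite subrr nrmY0 powR0.
case: ifP => _; last by rewrite subr0.
by rewrite subrr nrmY0 powR0.
Qed.

(** [y] is split into [P m y], to which the hypothesis applies, and a tail [Q m y] of small norm,
    which the boundedness of [lam_sub lam A] keeps harmless. *)
Lemma lower_bound_fin (r : R) A (lam : R[i]) (M : R) : p = r%:E ->
  bounded_op p A -> 0 <= M ->
  (forall m z, in_lp p z -> N (P m z) <= M * N (lam_sub lam A (P m z))) ->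
  forall y, in_lp p y -> N y <= M * N (lam_sub lam A y).
Proof.
move=> pr bA M0 H y yp.
have [C C0 hC] := bounded_lam_sub lam bA.
apply/ler_addgt0Pr => e e0.
(* A tail of norm at most [d] costs [d] directly and [M * C * d] through its image, hence the
   tolerance [e / (M * C + 1)]. *)
have D0 : 0 < M * C + 1 by rewrite ltr_wpDl // mulr_ge0.
have [m [Qp Qe]] := proj_approx pr yp (divr_gt0 e0 D0).
have [Pp _] := lpN_proj p1 (Gs m) yp.
have ysplit : y = (fun g => P m y g + Q m y g).
  by apply/funext => g; rewrite /opsub addrC subrK.
have [_ leN] := lpND p1 Pp Qp; rewrite -ysplit in leN.
have [Typ _] := hC _ yp; have [TQp leTQ] := hC _ Qp.
have TPE : lam_sub lam A (P m y) =
    (fun g => lam_sub lam A y g - lam_sub lam A (Q m y) g).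
  apply/funext => g; rewrite /lam_sub.
  have /(congr1 (@^~ g)) /= := bounded_opD bA Pp Qp; rewrite -ysplit => ->.
  rewrite [in RHS](_ : y g = P m y g + Q m y g); last first.
    by rewrite [in LHS]ysplit.
  by rewrite scalerDr opprD addrACA addrK.
have [_ leTP] := lpNB p1 Typ TQp; rewrite -TPE in leTP.
have hm := H m y yp.
set d := e / (M * C + 1) in Qe.
have dE : M * C * d + d = e by rewrite /d; field; rewrite gt_eqF.
have h1 : M * N (lam_sub lam A (P m y)) <= M * (N (lam_sub lam A y) + C * d).
  apply: ler_wpM2l => //; apply: le_trans leTP _; rewrite lerD2l.
  by apply: le_trans leTQ _; apply: ler_wpM2l.
by lra.
Qed.
End Exhaustion.

(** * Cutoffs for the sup norm *)

Section Level.
Variables (T : Type) (S : nat -> set T) (k : nat).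
Hypothesis S_incr : forall i, S i `<=` S i.+1.

(** The first [i < k] with [h] in [S i]; if there is none, [find] returns the length [k] of the
    list, which serves as the outermost level. *)
Definition level (h : T) : nat := find (fun i => `[< S i h >]) (iota 0 k).

Lemma incr_subset i j : (i <= j)%N -> S i `<=` S j.
Proof.
move=> /subnKC <-; elim: (j - i)%N => [|d IH]; rewrite ?addn0 // addnS.
by move=> g /IH /S_incr.
Qed.

Lemma level_le h : (level h <= k)%N.
Proof. by rewrite /level -[leqRHS](size_iota 0 k) find_size. Qed.

Lemma mem_level h : (level h < k)%N -> S (level h) h.
Proof.
move=> lk; apply/asboolP; rewrite -[X in `[< S X _ >]]add0n -(nth_iota 0 0 lk).
by apply: (@nth_find _ 0%N (fun i => `[< S i h >])); rewrite has_find size_iota.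
Qed.

Lemma notin_level i h : (i < level h)%N -> ~ S i h.
Proof.
move=> ih; have /(before_find 0%N) := ih.
rewrite nth_iota ?add0n; last exact: leq_trans ih (level_le h).
by move=> /negbT /asboolPn.
Qed.

Lemma level_leq_mem i h : S i h -> (level h <= i)%N.
Proof. by move=> Sh; rewrite leqNgt; apply/negP => /notin_level. Qed.

End Level.

Section SupNorm.
Variables (R : realType) (G : countGroupType) (Y : normedModType R[i]).
Variables (Gs : nat -> set G).
Hypothesis Gs_incr : forall m, exists N, forall n, (N <= n)%N -> Gs m `<=` Gs n.
Hypothesis Gs_cover : \bigcup_n Gs n = [set: G].
Implicit Types (x y : G -> Y) (A : Op G Y).

Local Notation P n := (@Defs.proj R G Y (Gs n)).
Local Notation Q n := (opsub id (@Defs.proj R G Y (Gs n))).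
Local Notation p := (+oo%E : \bar R).
Local Notation N := (lpN p).

Let p1 : (1 <= p)%E. Proof. by rewrite leey. Qed.

Lemma nrmY_le_lpN x g : in_lp p x -> nrmY (x g) <= N x.
Proof.
by move=> xp; apply: (proj1 (lpnormy_leP x (N x))); rewrite lpNE.
Qed.

Lemma lpN_le_nrmY x a : (forall g, nrmY (x g) <= a) -> in_lp p x /\ N x <= a.
Proof. by move=> h; apply/lpnorm_leE/lpnormy_leP. Qed.

(* The cutoff drops from 1 to 0 in [k] steps of height [1 / k], along levels
   that [A] couples, up to an error [d], only when they are adjacent. *)
Lemma exists_cutoff A m (e : R) : LXP p Gs A -> 0 < e ->
  exists (n : nat) (f : G -> R),
    [/\ forall h, 0 <= f h <= 1, forall h, Gs m h -> f h = 1,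
        forall h, ~ Gs n h -> f h = 0 &
        forall y, in_lp p y -> forall g,
          nrmY (A (fun h => (f h - f g)%:C%C *: y h) g) <= e * N y].
Proof.
move=> LA e0; have [bA _] := LA.
have [a [a0 _ hA]] := bounded_opE p1 bA.
(* One third of the error for each of the three pieces into which the argument of [A] is cut
   below. *)
pose d := e / 3.
have d0 : 0 < d by rewrite divr_gt0.
(* [nx i] is so far out that [A] couples [Gs i] with the complement of [Gs (nx i)] by at most [d].
   Iterating [nx] from [m] gives the nested sets [S j]. *)
have [nx hnx] : {nx : nat -> nat & forall i, Gs i `<=` Gs (nx i) /\
    forall x, in_lp p x ->
    [/\ in_lp p (Q (nx i) (A (P i x))), N (Q (nx i) (A (P i x))) <= d * N x,
        in_lp p (P i (A (Q (nx i) x))) & N (P i (A (Q (nx i) x))) <= d * N x]}.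
  apply: (@choice _ _ (fun i j => Gs i `<=` Gs j /\ forall x, in_lp p x ->
    [/\ in_lp p (Q j (A (P i x))), N (Q j (A (P i x))) <= d * N x,
        in_lp p (P i (A (Q j x))) & N (P i (A (Q j x))) <= d * N x])) => i.
  have [K1 h1] := Gs_incr i; have [K2 h2] := LXP_small p1 Gs_incr i LA d0.
  exists (maxn K1 K2); split; first by apply: h1; exact: leq_maxl.
  by apply: h2; exact: leq_maxr.
pose s j := iter j nx m; pose S j := Gs (s j).
have S_incr i : S i `<=` S i.+1 by have [] := hnx (s i).
(* [k] steps make [f] vary by at most [1 / k] between adjacent levels, and [a / k <= d] absorbs the
   norm bound [a] of [A]. *)
have [k k0 ka] : exists2 k, (0 < k)%N & a <= d * k%:R.
  exists (Num.truncn (a / d)).+1 => //.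
  rewrite mulrC -ler_pdivrMr //; apply: ltW; exact: truncnS_gt.
have kR0 : 0 < k%:R :> R by rewrite ltr0n.
pose l := level S k; pose f h : R := 1 - (l h)%:R / k%:R.
have fB h g : f h - f g = ((l g)%:R - (l h)%:R) / k%:R.
  by rewrite /f; field; rewrite gt_eqF.
have f01 h : 0 <= f h <= 1.
  rewrite /f subr_ge0 gerBl divr_ge0 ?ler0n // andbT.
  by rewrite ler_pdivrMr // mul1r ler_nat level_le.
have fB1 h g : `|f h - f g| <= 1.
  by have := f01 h; have := f01 g; rewrite ler_norml => /andP[? ?] /andP[? ?]; lra.
exists (s k), f; split=> //.
- move=> h mh; rewrite /f (_ : l h = 0%N) ?mul0r ?subr0 //.
  by apply/eqP; rewrite -leqn0; apply: (@level_leq_mem _ S).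
- move=> h nh; rewrite /f (_ : l h = k) ?divff ?subrr ?gt_eqF //.
  apply/eqP; rewrite eqn_leq level_le leqNgt; apply/negP => lk.
  by apply: nh; apply: (incr_subset S_incr (ltnW lk)); exact: mem_level.
move=> y yp g.
(* [E1] consists of the points at least two levels inside that of [g]; its guard excludes truncated
   subtraction. [E3] consists of the points beyond [S (l g).+1]; its guard ensures that [g] itself
   lies in [S (l g)]. Off both sets the levels of [h] and [g] differ by at most one. *)
pose E1 := [set h | (2 <= l g)%N /\ S (l g - 2)%N h].
pose E3 := [set h | (l g < k)%N /\ ~ S (l g).+1 h].
have restr (E : set G) (c : R) : 0 <= c -> (forall h, E h -> `|f h - f g| <= c) ->
    let z := fun h => if `[< E h >] then (f h - f g)%:C%C *: y h else 0 in
    in_lp p z /\ N z <= c * N y.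
  move=> c0 hE z; apply: lpN_le_nrmY => h; rewrite /z; case: asboolP => [Eh|_].
    rewrite nrmYZr; apply: ler_pM; rewrite ?nrmY_ge0 //; first exact: hE.
    exact: nrmY_le_lpN.
  by rewrite nrmY0 mulr_ge0 // lpN_ge0.
pose z (E : set G) := fun h => if `[< E h >] then (f h - f g)%:C%C *: y h else 0.
have [z1p z1N] := restr E1 1 ler01 (fun h _ => fB1 h g).
have [z3p z3N] := restr E3 1 ler01 (fun h _ => fB1 h g).
have [z2p z2N] : in_lp p (z (~` (E1 `|` E3))) /\
    N (z (~` (E1 `|` E3))) <= k%:R^-1 * N y.
  apply: restr; first by rewrite invr_ge0 ltW.
  move=> h /not_orP[nE1 nE3].
  rewrite fB normrM [`|k%:R^-1|]gtr0_norm ?invr_gt0 // ler_piMl ?invr_ge0 ?(ltW kR0)//.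
  have hlg : (l g <= (l h).+1)%N.
    rewrite leqNgt; apply/negP => hg; apply: nE1.
    have g2 : (2 <= l g)%N by apply: leq_trans hg.
    split=> //; apply: (@incr_subset _ _ S_incr (l h)).
      by rewrite leq_subRL // add2n.
    by apply: mem_level; apply: leq_trans (level_le S k g); apply: ltnW.
  have hlh : (l h <= (l g).+1)%N.
    have [gk|kg] := ltnP (l g) k; last first.
      by apply: leq_trans (level_le S k h) _; apply: leq_trans kg _.
    by apply: level_leq_mem; apply: contrapT => nS; apply: nE3.
  rewrite ler_norml; move: hlg hlh; rewrite -!(ler_nat R) -!natr1 => ? ?.
  by apply/andP; split; lra.
have -> : (fun h => (f h - f g)%:C%C *: y h) =
    (fun h => z E1 h + (z (~` (E1 `|` E3)) h + z E3 h)).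
  apply/funext => h; rewrite /z.
  case: (asboolP (E1 h)) => h1; case: (asboolP (E3 h)) => h3.
  (* [E1] and [E3] are disjoint, because [S (l g - 2)] is contained in [S (l g).+1]. *)
  - case: h1 h3 => g2 h1 [_ []]; apply: (incr_subset S_incr _ h1).
    by apply: leq_trans (leqnSn _); exact: leq_subr.
  - by rewrite ifF ?addr0 //; apply/asboolPn => -[]; left.
  - by rewrite ifF ?add0r //; apply/asboolPn => -[]; right.
  - by rewrite ifT ?addr0 ?add0r //; apply/asboolP => -[].
have [z23p _] := lpND p1 z2p z3p.
rewrite (bounded_opD bA z1p z23p) (bounded_opD bA z2p z3p).
apply: (le_trans (nrmYD _ _)).
have A0 : nrmY (A (fun=> 0) g) <= d * N y.
  by rewrite (bounded_op0 p1 bA) nrmY0 mulr_ge0 ?lpN_ge0 // ltW.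
rewrite mul1r in z1N z3N.
(* [z E1] is supported in [S (l g - 2)], while [g] lies outside the next set of the chain, so the
   value at [g] is seen by [Q] after [A] after [P]. *)
have b1 : nrmY (A (z E1) g) <= d * N y.
  have [g2|g2] := leqP 2 (l g); last first.
    rewrite (_ : z E1 = (fun=> 0)) //; apply/funext => h; rewrite /z.
    by rewrite ifF //; apply/asboolPn => -[]; rewrite leqNgt g2.
  have [_ /(_ _ z1p) [Bp BN _ _]] := hnx (s (l g - 2)%N).
  have Pz : P (s (l g - 2)%N) (z E1) = z E1.
    apply/funext => h; rewrite /Defs.proj; case: asboolP => // nS.
    by rewrite /z ifF //; apply/asboolPn => -[].
  rewrite Pz in Bp BN.
  have ng : ~ Gs (nx (s (l g - 2)%N)) g.
    apply: (@notin_level _ S k (l g - 2).+1 g).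
    by rewrite -/(l g) -[leqRHS](subnKC g2) add2n.
  apply: (@le_trans _ _ (d * N (z E1))); last by rewrite ler_wpM2l // ltW.
  apply: le_trans BN; apply: le_trans (nrmY_le_lpN g Bp).
  by rewrite /opsub /Defs.proj; case: asboolP => // _; rewrite subr0.
(* The opposite direction: [g] lies in [S (l g)] and [z E3] vanishes on the next set, so the bound
   on [P] after [A] after [Q] applies. *)
have b3 : nrmY (A (z E3) g) <= d * N y.
  have [gk|kg] := ltnP (l g) k; last first.
    rewrite (_ : z E3 = (fun=> 0)) //; apply/funext => h; rewrite /z.
    by rewrite ifF //; apply/asboolPn => -[]; rewrite ltnNge kg.
  have [_ /(_ _ z3p) [_ _ Bp BN]] := hnx (s (l g)).
  have Qz : Q (nx (s (l g))) (z E3) = z E3.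
    apply/funext => h; rewrite /opsub /Defs.proj; case: asboolP => Sh.
      by rewrite subrr /z ifF //; apply/asboolPn => -[].
    by rewrite subr0.
  rewrite Qz in Bp BN.
  apply: (@le_trans _ _ (d * N (z E3))); last by rewrite ler_wpM2l // ltW.
  apply: le_trans BN; apply: le_trans (nrmY_le_lpN g Bp).
  have gS : Gs (s (l g)) g := mem_level gk.
  by rewrite /Defs.proj; case: asboolP.
have b2 : nrmY (A (z (~` (E1 `|` E3))) g) <= d * N y.
  have [Azp AzN] := hA _ z2p.
  apply: le_trans (nrmY_le_lpN g Azp) _; apply: le_trans AzN _.
  apply: (@le_trans _ _ (a * (k%:R^-1 * N y))); first exact: ler_wpM2l.
  by rewrite mulrA ler_wpM2r ?lpN_ge0 // ler_pdivrMr.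
have := nrmYD (A (z (~` (E1 `|` E3))) g) (A (z E3) g).
have -> : e = 3 * d by rewrite /d; field.
by lra.
Qed.

(** The sup norm is tested at one point [g0]. A cutoff [f] equal to 1 at [g0] and supported in some
    [Gs n] puts [f y] in the range of [P n], where the hypothesis applies; since [f] almost commutes
    with [A], the image of [f y] is hardly larger than that of [y]. *)
Lemma lower_bound_sup A (lam : R[i]) (M : R) : LXP p Gs A -> 0 <= M ->
  (forall m z, in_lp p z -> N (P m z) <= M * N (lam_sub lam A (P m z))) ->
  forall y, in_lp p y -> N y <= M * N (lam_sub lam A y).
Proof.
move=> LA M0 H y yp; have [bA _] := LA.
have [C C0 hC] := bounded_lam_sub p1 lam bA.
have [Typ _] := hC _ yp.
apply: (proj2 (lpN_le_nrmY _)) => g0.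
have [m _ mg0] : (\bigcup_n Gs n) g0 by rewrite Gs_cover.
apply/ler_addgt0Pr => e e0.
have Ny0 : 0 <= N y := lpN_ge0 _ _.
have D0 : 0 < M * N y + 1 by rewrite ltr_wpDl // mulr_ge0.
have [n [f [f01 f1 f0 comm]]] := exists_cutoff m LA (divr_gt0 e0 D0).
set d := e / (M * N y + 1) in comm.
have dE : M * (d * N y) <= e.
  have d0 : 0 <= d by rewrite divr_ge0 ?ltW.
  have : M * (d * N y) + d = e by rewrite /d; field; rewrite gt_eqF.
  by lra.
pose z h := (f h)%:C%C *: y h.
have [zp zN] : in_lp p z /\ N z <= N y.
  apply: lpN_le_nrmY => h; rewrite nrmYZr; have /andP[fh0 fh1] := f01 h.
  rewrite ger0_norm //; apply: le_trans (nrmY_le_lpN h yp).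
  by rewrite ler_piMl // nrmY_ge0.
have Pz : P n z = z.
  apply/funext => h; rewrite /Defs.proj; case: asboolP => // /f0 fh.
  by rewrite /z fh scale0r.
have := H n z zp; rewrite Pz => Hz.
have TzN : N (lam_sub lam A z) <= N (lam_sub lam A y) + d * N y.
  apply: (proj2 (lpN_le_nrmY _)) => g.
  (* Freezing [f] at its value at [g] gives [z = u + f g *: y], so [A u g] is the commutator of [A]
     with [f], applied to [y] and evaluated at [g]. *)
  pose u h := (f h - f g)%:C%C *: y h.
  have [fyp _] := lpNZ_le p1 (f g)%:C%C yp.
  have zE : z = (fun h => u h + (f g)%:C%C *: y h).
    by apply/funext => h; rewrite /u -scalerDl -rmorphD /= subrK.
  have up : in_lp p u.
    suff -> : u = (fun h => z h - (f g)%:C%C *: y h) by exact: (lpNB p1 zp fyp).1.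
    by apply/funext => h; rewrite zE addrK.
  have Azg : A z g = A u g + (f g)%:C%C *: A y g.
    by rewrite zE (bounded_opD bA up fyp) (bounded_op_homog p1 bA).
  have -> : lam_sub lam A z g = (f g)%:C%C *: lam_sub lam A y g + - A u g.
    rewrite /lam_sub Azg /z scalerBr !scalerA (mulrC lam) opprD.
    by rewrite addrA addrAC.
  apply: (le_trans (nrmYD _ _)); rewrite nrmYN; apply: lerD; last exact: comm.
  have /andP[fg0 fg1] := f01 g; rewrite nrmYZr ger0_norm //.
  apply: le_trans (nrmY_le_lpN g Typ); by rewrite ler_piMl // nrmY_ge0.
have yz : nrmY (y g0) <= N z.
  by apply: le_trans (nrmY_le_lpN g0 zp); rewrite /z f1 // scale1r.
have := ler_wpM2l M0 TzN; rewrite mulrDr; lra.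
Qed.
End SupNorm.

(** * Resolvents along a family of operators *)

Lemma lower_bound_of_proj (R : realType) (G : countGroupType)
    (Y : normedModType R[i]) (p : \bar R) (Gs : nat -> set G) (A : Op G Y)
    (lam : R[i]) (M : R) : (1 <= p)%E ->
  (forall m, exists N, forall n, (N <= n)%N -> Gs m `<=` Gs n) ->
  \bigcup_n Gs n = [set: G] -> LXP p Gs A -> 0 <= M ->
  (forall m z, in_lp p z ->
    lpN p (Defs.proj (Gs m) z) <= M * lpN p (lam_sub lam A (Defs.proj (Gs m) z))) ->
  forall y, in_lp p y -> lpN p y <= M * lpN p (lam_sub lam A y).
Proof.
case: p => [r||] // p1 incr cover LA M0 H.
  by have [bA _] := LA; exact: (lower_bound_fin p1 incr cover erefl bA M0).
exact: (lower_bound_sup incr cover LA M0 H).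
Qed.

Section Family.
Variables (R : realType) (G : countGroupType) (Y : normedModType R[i]).
Variables (p : \bar R) (p1 : (1 <= p)%E) (Gs : nat -> set G).
Hypothesis Gs_incr : forall m, exists N, forall n, (N <= n)%N -> Gs m `<=` Gs n.
Hypothesis Gs_cover : \bigcup_n Gs n = [set: G].
Variables (Omega : pseudoMetricType R) (alpha : G -> Omega -> Omega).
Variables (A : Omega -> Op G Y) (lam : R[i]).
Hypothesis famA : op_family p Gs alpha A.

Local Notation P n := (@Defs.proj R G Y (Gs n)).
Local Notation N := (lpN p).
Local Notation T w := (lam_sub lam (A w)).

(* The operators [A (alpha g w)] are isometric conjugates of [A w], so they
   share its lower bound, which then survives the P-strong limit. *)
Lemma lower_bound_limit (w nu : Omega) (gs : nat -> G) (B : Op G Y) (M : R) :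
  (fun n => alpha (gs n) w) @ \oo --> nu ->
  is_inverse p (T w) B -> opnorm p B = M%:E -> 0 <= M ->
  forall m z, in_lp p z -> N (P m z) <= M * N (T nu (P m z)).
Proof.
move=> cvg_nu [bB _ BT] BM M0 m z zp.
have [LA eqA limA] := famA.
have bA v : bounded_op p (A v) by have [] := LA v.
have hB : forall x, in_lp p x -> in_lp p (B x) /\ N (B x) <= M * N x.
  by apply: opnorm_le; [|exact: bounded_op_homog|rewrite BM].
have [Pzp _] := lpN_proj p1 (Gs m) zp.
set v := P m z in Pzp *.
apply/ler_addgt0Pr => e e0.
(* The approximation error is relative to [N z] and is later multiplied by [M]; the added 1 keeps
   the divisor positive. *)
have D0 : 0 < M * N z + 1 by rewrite ltr_wpDl // mulr_ge0 // lpN_ge0.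
have [n hn] := Plim_small p1 Gs_incr m (fun n => bA _) (bA _)
  (limA _ _ cvg_nu) (divr_gt0 e0 D0).
set d := e / _ in hn; set wn := alpha (gs n) w in hn.
have dE : M * (d * N z) <= e.
  have d0 : 0 <= d by rewrite divr_ge0 ?ltW.
  have : M * (d * N z) + d = e by rewrite /d; field; rewrite gt_eqF.
  by lra.
have [C C0 hC] := bounded_lam_sub p1 lam (bA nu).
have [Cw _ hCw] := bounded_lam_sub p1 lam (bA w).
have [Tvp _] := hC _ Pzp.
(* Covariance turns the operator at [wn], applied to [v], into the shift of the operator at [w],
   applied to [u]. As shifts are isometric, the left inverse [B] at [w] bounds [v] as well. *)
pose u := Defs.shift (gs n)^-1%g v.
have up : in_lp p u by exact: in_lp_shift.
have shiftK : Defs.shift (gs n) u = v.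
  by apply/funext => h; rewrite /u /Defs.shift mulgK.
have shiftT : Defs.shift (gs n) (T w u) = T wn v.
  have Av : A wn v = Defs.shift (gs n) (A w u) by rewrite /wn eqA.
  have vE h : v h = u (h * gs n)%g by rewrite -[in LHS]shiftK.
  by apply/funext => h; rewrite /lam_sub Av vE.
have Nv : N v <= M * N (T wn v).
  rewrite -shiftT lpN_shift -[in leLHS]shiftK lpN_shift.
  have [Tup _] := hCw _ up.
  by have := (hB _ Tup).2; have /= -> := BT u up.
have Dp : in_lp p (fun g => A wn v g - A nu v g).
  apply: (lpNB p1 _ _).1; [by case: (bA wn) => h _ _; exact: h|].
  by case: (bA nu) => h _ _; exact: h.
have TE : T wn v = (fun g => T nu v g - (A wn v g - A nu v g)).
  by apply/funext => g; rewrite /lam_sub opprB addrA subrK.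
have [_ TN] := lpNB p1 Tvp Dp; rewrite -TE in TN.
have := ler_wpM2l M0 (le_trans TN (lerD (lexx _) (hn z zp))).
by rewrite mulrDr; lra.
Qed.

(** The lower bound for [T nu], applied to [B2 x], bounds [B2 x] by [M] times the norm of
    [T nu (B2 x) = x]. *)
Lemma opnorm_inverse_limit_le (w nu : Omega) (gs : nat -> G) (B1 B2 : Op G Y) :
  (fun n => alpha (gs n) w) @ \oo --> nu ->
  is_inverse p (T w) B1 -> is_inverse p (T nu) B2 ->
  (opnorm p B2 <= opnorm p B1)%E.
Proof.
move=> cvg_nu inv1 inv2.
have [bB1 _ _] := inv1; have [bB2 TB _] := inv2.
have [M [M0 BM _]] := bounded_opE p1 bB1.
have H := lower_bound_limit cvg_nu inv1 BM M0.
have [LA _ _] := famA.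
have lower : forall y, in_lp p y -> N y <= M * N (T nu y).
  exact: lower_bound_of_proj (LA nu) M0 H.
rewrite BM; apply: le_opnorm => x xp x1.
have [B2lp _ _] := bB2; split; first exact: B2lp.
have := lower _ (B2lp _ xp); have /= -> := TB x xp.
move=> /le_trans; apply; rewrite -[leRHS]mulr1; exact: ler_wpM2l.
Qed.

End Family.

(** Orbit points are chosen in the balls of radius [1 / (n + 1)] around [nu]. In the minimal case
    this supplies the convergent sequence that [limit_set] provides in the pseudoergodic case. *)
Lemma closure_orbit_seq (R : realType) (G : Type) (Omega : pseudoMetricType R)
    (a : G -> Omega) (nu : Omega) :
  closure (range a) nu -> exists gs : nat -> G, (fun n => a (gs n)) @ \oo --> nu.
Proof.
move=> cl.
have [gs hgs] : {gs : nat -> G & forall n, ball nu n.+1%:R^-1 (a (gs n))}.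
  apply: (@choice _ _ (fun n g => ball nu n.+1%:R^-1 (a g))) => n.
  have e0 : 0 < n.+1%:R^-1 :> R by rewrite invr_gt0.
  by have [_ [[g _ <-] hg]] := cl _ (nbhsx_ballx nu _ e0); exists g.
exists gs; apply/cvg_ballP => e e0; near=> n.
apply: le_ball (hgs n); apply: ltW; near: n; exact: (near_infty_natSinv_lt (PosNum e0)).
Unshelve. all: by end_near.
Qed.

Theorem theorem4p7
  (R : realType) (p : \bar R) (hp : (1 <= p)%E)
  (Y : completeNormedModType R[i]) (G : countGroupType)
  (Gs : nat -> set G)
  (hGs_ne : forall n, Gs n !=set0) (hGs_proper : forall n, Gs n <> [set: G])
  (hGs_incr : forall m, exists N, forall n, (N <= n)%N -> Gs m `<=` Gs n)
  (hGs_cover : \bigcup_n Gs n = [set: G])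
  (Omega : pseudoMetricType R)
  (hOmega_cpt : compact [set: Omega]) (hOmega_T2 : hausdorff_space Omega)
  (alpha : G -> Omega -> Omega) (halpha : dyn_system alpha)
  (A : Omega -> Op G Y) (hA : op_family p Gs alpha A)
  (lam : R[i]) (hlam : forall w : Omega, ~ in_spectrum p (A w) lam) :
  (forall (w nu : Omega) (B1 B2 : Op G Y),
      pseudoergodic alpha w -> pseudoergodic alpha nu ->
      is_inverse p (lam_sub lam (A w)) B1 ->
      is_inverse p (lam_sub lam (A nu)) B2 ->
      opnorm p B1 = opnorm p B2) /\
  (minimal_system alpha ->
   forall (w nu : Omega) (B1 B2 : Op G Y),
      is_inverse p (lam_sub lam (A w)) B1 ->
      is_inverse p (lam_sub lam (A nu)) B2 ->
      opnorm p B1 = opnorm p B2).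
Proof.
have le_lim := opnorm_inverse_limit_le hp hGs_incr hGs_cover hA.
split=> [w nu B1 B2 ergw ergnu inv1 inv2|minA w nu B1 B2 inv1 inv2].
- have [gs1 [_ c1]] : limit_set alpha w nu by rewrite ergw.
  have [gs2 [_ c2]] : limit_set alpha nu w by rewrite ergnu.
  by apply/eqP; rewrite eq_le (le_lim _ _ _ _ _ _ c1 inv1 inv2)
    (le_lim _ _ _ _ _ _ c2 inv2 inv1).
- have [|gs1 c1] := @closure_orbit_seq _ _ _ (alpha^~ w) nu; first by rewrite minA.
  have [|gs2 c2] := @closure_orbit_seq _ _ _ (alpha^~ nu) w; first by rewrite minA.
  by apply/eqP; rewrite eq_le (le_lim _ _ _ _ _ _ c1 inv1 inv2)
    (le_lim _ _ _ _ _ _ c2 inv2 inv1).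
Qed.
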